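(* Let $B=\{B_t,\ t\ge0\}$ be a centered Gaussian process with stationary increments and $B_0=0$, let $X_t=\theta t+B_t$, and let $h>0$. Assume that for every $N\ge1$ the Gaussian distribution of $(B_{kh})_{k=1}^N$ is nonsingular, and that $$\mathbb{E}\big[(B_{(k+1)h}-B_{kh})B_h\big]\to 0\quad\text{as }k\to\infty.$$ Let $\hat\theta^{(N)}$ be the maximum likelihood estimator of $\theta$ based on the observations $X_{kh}$, $k=1,\dots,N$, namely $$\hat\theta^{(N)}=\frac{z^\top(\Gamma^{(N)})^{-1}\Delta X^{(N)}}{z^\top(\Gamma^{(N)})^{-1}z},$$ with $z=(h,\dots,h)^\top\in\mathbb{R}^N$. Then $\hat\theta^{(N)}$ is mean-square consistent: $\mathbb{E}(\hat\theta^{(N)}-\theta)^2\to0$ as $N\to\infty$.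
   Context: Here $\Delta X^{(N)}=(X_{kh}-X_{(k-1)h})_{k=1}^N$, $\Delta B^{(N)}=(B_{kh}-B_{(k-1)h})_{k=1}^N$, and $\Gamma^{(N)}$ is the covariance matrix of $\Delta B^{(N)}$. *)

(* Defs.v *)
From HB Require Import structures.
From mathcomp Require Import all_boot all_order all_algebra.
From mathcomp Require Import all_classical all_reals all_analysis.
Set Implicit Arguments. Unset Strict Implicit. Unset Printing Implicit Defensive.
Import Order.TTheory GRing.Theory Num.Theory.
Local Open Scope classical_set_scope.
Local Open Scope ring_scope.

Section defs.
Context {d} {T : measurableType d} {R : realType} (P : probability T R).

Definition centered_gaussian (Y : T -> R) : Prop :=
  (exists s : R, s != 0 /\
     forall A : set R, measurable A -> P (Y @^-1` A) = normal_prob (0:R) s A)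
  \/ (forall A : set R, measurable A -> P (Y @^-1` A) = \d_(0%R : R) A).

Definition centered_gaussian_process (B : R -> T -> R) : Prop :=
  forall (n : nat) (t : 'I_n -> R) (a : 'I_n -> R),
    (forall i, 0 <= t i) ->
    centered_gaussian (fun w => \sum_(i < n) a i * B (t i) w).

(* Stationary increments: for every s >= 0 the process (B_{t+s} - B_s)_{t>=0}
   has the same finite-dimensional distributions as (B_t)_{t>=0}; stated via
   the laws of all finite linear combinations (Cramer-Wold). *)
Definition stationary_increments (B : R -> T -> R) : Prop :=
  forall (s : R) (n : nat) (t : 'I_n -> R) (a : 'I_n -> R),
    0 <= s -> (forall i, 0 <= t i) ->
    forall A : set R, measurable A ->
      P ((fun w => \sum_(i < n) a i * (B (t i + s) w - B s w)) @^-1` A) =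
      P ((fun w => \sum_(i < n) a i * B (t i) w) @^-1` A).

Definition cov_values (B : R -> T -> R) (h : R) (N : nat) : 'M[R]_N :=
  \matrix_(i < N, j < N)
    fine (covariance P (B (i.+1%:R * h)) (B (j.+1%:R * h))).

Definition incr (Y : R -> T -> R) (h : R) (N : nat) (w : T) : 'cV[R]_N :=
  \col_(i < N) (Y (i.+1%:R * h) w - Y (i%:R * h) w).

Definition Gamma (B : R -> T -> R) (h : R) (N : nat) : 'M[R]_N :=
  \matrix_(i < N, j < N)
    fine (covariance P (fun w => B (i.+1%:R * h) w - B (i%:R * h) w)
                       (fun w => B (j.+1%:R * h) w - B (j%:R * h) w)).

Definition theta_hat (B : R -> T -> R) (theta h : R) (N : nat) (w : T) : R :=
  let z : 'cV[R]_N := const_mx h in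
  let X := fun t w' => theta * t + B t w' in
  ((z^T *m invmx (Gamma B h N) *m incr X h N w) 0 0) /
  ((z^T *m invmx (Gamma B h N) *m z) 0 0).

End defs.

(* Main.v *)
(* The weights of the estimator are the best linear unbiased ones: with
   [u = z^T Gamma^-1 / (z^T Gamma^-1 z)] the error is [sum_i u_i dB_i], and its
   second moment [u Gamma u^T] is at most [v Gamma v^T] for every row vector [v]
   with [v z = 1] (Gauss-Markov). For the constant [v] this upper bound is
   [Var (B_{Nh}) / (N h)^2]. By stationarity,
   [Var (B_{(n+1)h}) - Var (B_{nh}) <= 2 sum_(k <= n) |r k|], where [r k] is the
   covariance of [B_{(k+1)h} - B_{kh}] and [B_h], so the mean square error is at
   most [2 / h^2] times a Cesaro mean of [|r|], which tends to 0. *)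
Require Import Defs.
From HB Require Import structures.
From mathcomp Require Import all_boot all_order all_algebra.
From mathcomp Require Import all_classical all_reals all_analysis.
From mathcomp Require Import measurable_realfun ring lra.
Set Implicit Arguments. Unset Strict Implicit. Unset Printing Implicit Defensive.
Import Order.TTheory GRing.Theory Num.Theory.
Import numFieldNormedType.Exports.
Local Open Scope classical_set_scope.
Local Open Scope ring_scope.

(** * Symmetry and second moment of centered normal laws *)

(** By uniqueness of Lebesgue measure it suffices to check the intervals []a, b]]; reflection swaps
    their open and closed ends but keeps their length. *)
Lemma lebesgue_measureN (R : realType) (A : set R) : measurable A ->
  lebesgue_measure (-%R @^-1` A) = lebesgue_measure A.
Proof.
move=> mA; have mN : measurable_fun [set: measurableTypeR R]
    (-%R : measurableTypeR R -> measurableTypeR R).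
  exact: oppr_measurable.
pose N : {mfun measurableTypeR R >-> measurableTypeR R} :=
  HB.pack (-%R : measurableTypeR R -> measurableTypeR R)
    (isMeasurableFun.Build _ _ _ _ _ mN).
symmetry; apply: (@lebesgue_measure_unique R (pushforward lebesgue_measure N)) => //.
move=> X [[a b] _ <-] /=; rewrite /pushforward /=.
have -> : -%R @^-1` `]a, b]%classic = `[- b, - a[%classic :> set R.
  by apply/seteqP; split => x; rewrite /= !in_itv/= => /andP[? ?]; apply/andP; lra.
rewrite [LHS]lebesgue_measure_itv [RHS]lebesgue_measure_itv/= !lte_fin ltrN2.
by case: ifP => // _; rewrite -!EFinB opprK addrC.
Qed.

Lemma normal_prob0N (R : realType) (s : R) (A : set R) : s != 0 -> measurable A ->
  normal_prob 0 s (-%R @^-1` A) = normal_prob 0 s A.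
Proof.
move=> s0 mA; rewrite /normal_prob.
have pdfN (x : R) : normal_pdf 0 s (- x) = normal_pdf 0 s x.
  by rewrite !normal_pdfE// /normal_fun !subr0 sqrrN.
have mN : measurable_fun [set: measurableTypeR R]
    (-%R : measurableTypeR R -> measurableTypeR R).
  exact: oppr_measurable.
under eq_integral do rewrite -pdfN.
rewrite -(@ge0_integral_pushforward _ _ _ _ R _ mN lebesgue_measure A
  (fun x => (normal_pdf 0 s x)%:E))//; last 2 first.
- by apply/measurable_EFinP/measurable_funTS; exact: measurable_normal_pdf.
- by move=> x _; rewrite lee_fin normal_pdf_ge0.
apply: eq_measure_integral => X mX _; exact: lebesgue_measureN.
Qed.

(** Change of variables produces the Radon-Nikodym derivative of [normal_prob]. It agrees almost
    everywhere with the density, because both have the same integral over every measurable set. *)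
Lemma ge0_integral_normal_prob (R : realType) (m s : R)
    (f : measurableTypeR R -> \bar R) :
  measurable_fun setT f -> (forall x, (0 <= f x)%E) ->
  (\int[normal_prob m s]_x f x =
   \int[lebesgue_measure]_x (f x * (normal_pdf m s x)%:E))%E.
Proof.
move=> mf f0; have dom := @normal_prob_dominates R m s.
have mpdf : measurable_fun [set: measurableTypeR R] (fun x => (normal_pdf m s x)%:E).
  by apply/measurable_EFinP; exact: measurable_normal_pdf.
rewrite -(Radon_Nikodym_SigmaFinite.change_of_variables dom)//.
have iRN := Radon_Nikodym_SigmaFinite.f_integrable dom.
apply: ae_eq_integral => //.
- by apply: emeasurable_funM => //; exact: (measurable_int _ iRN).
- exact: emeasurable_funM.
- apply: ae_eqe_mul2l; apply: integral_ae_eq => //.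
  by move=> E _ mE; rewrite -Radon_Nikodym_SigmaFinite.f_integral.
Qed.

(* With [t = x^2 / (4 s^2)], the bound [t <= exp t] gives
   [x^2 exp (- 2 t) <= 4 s^2 exp (- t)], a multiple of the density of
   [N(0, 2 s^2)]. *)
Lemma normal_prob_sqr_lty (R : realType) (s : R) : s != 0 ->
  (\int[normal_prob 0 s]_x (x ^+ 2)%:E < +oo)%E.
Proof.
move=> s0; rewrite ge0_integral_normal_prob; last 2 first.
  by apply/measurable_EFinP; exact: measurable_funX.
  by move=> x; rewrite lee_fin sqr_ge0.
pose s' : R := s * Num.sqrt 2.
have s'0 : s' != 0 by rewrite mulf_neq0// sqrtr_eq0 -ltNge.
have s2 : s' ^+ 2 = s ^+ 2 *+ 2 by rewrite exprMn sqr_sqrtr// mulr_natr.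
have sp : 0 < s ^+ 2 by rewrite exprn_even_gt0.
pose K : R := (s ^+ 2 *+ 4) * (normal_peak s / normal_peak s').
have K0 : 0 <= K by rewrite !mulr_ge0 ?invr_ge0 ?normal_peak_ge0// mulrn_wge0 ?ltW.
have bound (x : R) : x ^+ 2 * normal_pdf 0 s x <= K * normal_pdf 0 s' x.
  rewrite !normal_pdfE// /normal_fun !subr0.
  pose t : R := x ^+ 2 / (s ^+ 2 *+ 4).
  have s4 : s ^+ 2 *+ 4 != 0 by rewrite mulrn_eq0/= gt_eqF.
  have -> : - x ^+ 2 / (s' ^+ 2 *+ 2) = - t by rewrite s2 -mulrnA mulNr.
  have -> : - x ^+ 2 / (s ^+ 2 *+ 2) = - t - t by rewrite /t; field.
  have -> : x ^+ 2 = s ^+ 2 *+ 4 * t by rewrite /t mulrC divfK.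
  have pk : normal_peak s' != 0 by rewrite gt_eqF ?normal_peak_gt0.
  have -> : K * (normal_peak s' * expR (- t)) =
      s ^+ 2 *+ 4 * (normal_peak s * expR (- t)) by rewrite /K; field.
  rewrite -mulrA ler_wpM2l ?mulrn_wge0 ?(ltW sp)//.
  rewrite mulrCA ler_wpM2l ?normal_peak_ge0// expRD mulrA ler_piMl ?expR_ge0//.
  rewrite expRN ler_pdivrMr ?expR_gt0// mul1r.
  by apply: le_trans (expR_ge1Dx t); rewrite lerDr.
apply: (@le_lt_trans _ _ (\int[lebesgue_measure]_x (K%:E * (normal_pdf 0 s' x)%:E))%E).
  apply: ge0_le_integral => //=.
  - by move=> x _; rewrite mule_ge0// lee_fin ?sqr_ge0 ?normal_pdf_ge0.
  - apply: emeasurable_funM; apply/measurable_EFinP; last exact: measurable_normal_pdf.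
    exact: measurable_funX.
  - apply: emeasurable_funM => //; apply/measurable_EFinP; exact: measurable_normal_pdf.
  - by move=> x _; rewrite -!EFinM lee_fin.
rewrite integralZl//; last exact: integrable_normal_pdf.
by rewrite integral_normal_pdf mule1 ltry.
Qed.

(** * Moments of a random variable from its law *)

Lemma expectation_eq_law d (T : measurableType d) (R : realType)
    (P : probability T R) (X Y : T -> R) (f : R -> R) :
  measurable_fun setT X -> measurable_fun setT Y -> measurable_fun setT f ->
  (forall A : set R, measurable A -> P (X @^-1` A) = P (Y @^-1` A)) ->
  (f \o X) \in Lfun P 1 -> (f \o Y) \in Lfun P 1 ->
  ('E_P[f \o X] = 'E_P[f \o Y])%E.
Proof.
move=> mX mY mf XY /Lfun1_integrable iX /Lfun1_integrable iY.
have mEf : measurable_fun setT (EFin \o f) by apply/measurable_EFinP.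
rewrite unlock.
rewrite -(@integral_pushforward _ _ _ _ _ X mX P setT (EFin \o f))//.
rewrite -(@integral_pushforward _ _ _ _ _ Y mY P setT (EFin \o f))//.
pose X' : {mfun T >-> R} := HB.pack X (isMeasurableFun.Build _ _ _ _ _ mX).
pose Y' : {mfun T >-> R} := HB.pack Y (isMeasurableFun.Build _ _ _ _ _ mY).
apply: (@eq_measure_integral _ _ _ _ (distribution P Y') (distribution P X')).
by move=> A mA _; exact: XY.
Qed.

Lemma Lfun2_sqr_lty d (T : measurableType d) (R : realType)
    (P : probability T R) (X : T -> R) : measurable_fun setT X ->
  (\int[P]_w (X w ^+ 2)%:E < +oo)%E -> X \in Lfun P 2%:E.
Proof.
move=> mX Xoo; rewrite inE; apply/andP; split; rewrite inE//=.
rewrite /finite_norm unlock /Lnorm poweR_lty//.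
rewrite (eq_integral (fun w => (X w ^+ 2)%:E))// => w _ /=.
by rewrite powR_mulrn// real_normK ?num_real.
Qed.

(** The second moment is an integral against the law of [X], which is either normal or the Dirac
    mass at 0 of the degenerate case. *)
Lemma centered_gaussian_Lfun2 d (T : measurableType d) (R : realType)
    (P : probability T R) (X : T -> R) : measurable_fun setT X ->
  centered_gaussian P X -> X \in Lfun P 2%:E.
Proof.
move=> mX gX; apply: Lfun2_sqr_lty => //.
have mX' : measurable_fun [set: T] (X : T -> measurableTypeR R) by exact: mX.
pose X' : {mfun T >-> measurableTypeR R} :=
  HB.pack (X : T -> measurableTypeR R) (isMeasurableFun.Build _ _ _ _ _ mX').
pose f : measurableTypeR R -> \bar R := fun x => (x ^+ 2)%:E.
have mf : measurable_fun setT f by apply/measurable_EFinP; exact: measurable_funX.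
rewrite -(@ge0_integral_distribution _ _ _ _ _ P X' f)//; last first.
  by move=> y; rewrite lee_fin sqr_ge0.
case: gX => [[s [s0 law]]|law].
  rewrite (eq_measure_integral (normal_prob 0 s)); last by move=> A mA _; exact: law.
  exact: normal_prob_sqr_lty.
rewrite (eq_measure_integral (\d_(0 : measurableTypeR R))); last by move=> A mA _; exact: law.
by rewrite integral_dirac// diracT mul1e ltry.
Qed.

(** By symmetry of the law, [X] and [- X] have the same expectation; it is finite, hence equal to
    0. *)
Lemma centered_gaussian_mean0 d (T : measurableType d) (R : realType)
    (P : probability T R) (X : T -> R) : measurable_fun setT X ->
  centered_gaussian P X -> 'E_P[X]%E = 0%E.
Proof.
move=> mX gX.
have Xfin : X \in Lfun P 1.
  apply: Lfun_subset12; first exact: fin_num_measure.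
  exact: centered_gaussian_Lfun2.
have NXfin : (-%R \o X) \in Lfun P 1 by rewrite -[_ \o _]/(- X) rpredN.
have NX : ('E_P[-%R \o X] = 'E_P[X])%E.
  apply: (@expectation_eq_law _ _ _ P (-%R \o X) X id) => //.
    exact: measurableT_comp.
  move=> A mA; rewrite comp_preimage.
  have mNA : measurable (-%R @^-1` A : set R).
    by rewrite -[X in measurable X]setTI; exact: oppr_measurable.
  case: gX => [[s [s0 law]]|law]; rewrite !law//; first exact: normal_prob0N.
  rewrite !diracE; congr ((nat_of_bool _)%:R%:E).
  by apply/idP/idP; rewrite !inE/= oppr0.
have : ('E_P[-%R \o X] = - 'E_P[X])%E.
  rewrite (_ : -%R \o X = -1 \o* X); last by apply/funext => w /=; rewrite mulrN1.
  by rewrite expectationZl// mulN1e.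
rewrite NX; move: (expectation_fin_num Xfin) => /fineK <-.
by rewrite -EFinN => -[] xN; congr EFin; lra.
Qed.

(** * Positive semidefinite forms and the Gauss-Markov inequality *)

Section quadratic_form.
Context (R : realFieldType) (n : nat) (G : 'M[R]_n).
Hypothesis symG : G^T = G.
Hypothesis psdG : forall x : 'rV_n, 0 <= (x *m G *m x^T) 0 0.

Lemma quadratic_formC (x y : 'rV_n) :
  (x *m G *m y^T) 0 0 = (y *m G *m x^T) 0 0.
Proof.
transitivity ((x *m G *m y^T)^T 0 0); first by rewrite [RHS]mxE.
by rewrite !trmx_mul trmxK symG mulmxA.
Qed.

Lemma quadratic_formDZ (x y : 'rV_n) (t : R) :
  ((x + t *: y) *m G *m (x + t *: y)^T) 0 0 =
  (x *m G *m x^T) 0 0 + t * (x *m G *m y^T) 0 0 *+ 2 +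
  t ^+ 2 * (y *m G *m y^T) 0 0.
Proof.
rewrite linearD linearZ/= !mulmxDl !mulmxDr -!scalemxAl -!scalemxAr.
have addE (A B : 'M[R]_1) : (A + B) 0 0 = A 0 0 + B 0 0 by rewrite mxE.
have scaleE a (A : 'M[R]_1) : (a *: A) 0 0 = a * A 0 0 by rewrite mxE.
by rewrite !(addE, scaleE) (quadratic_formC y x); ring.
Qed.

(** If [x G y^T] were nonzero, a step from [x] along [y] against its sign would make the form
    negative. *)
Lemma psd_kernel (x : 'rV_n) : (x *m G *m x^T) 0 0 = 0 ->
  forall y : 'rV_n, (x *m G *m y^T) 0 0 = 0.
Proof.
move=> x0 y; apply/eqP/negPn/negP => b0.
set b := (x *m G *m y^T) 0 0 in b0; set c := (y *m G *m y^T) 0 0.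
have c0 : 0 <= c by exact: psdG.
have c1 : 0 < c + 1 by rewrite ltr_wpDl.
(* With this step the form equals [- b^2 (c + 2) / (c + 1)^2]. The [+ 1] keeps the denominator
   positive even when [c = 0]. *)
have := psdG (x + (- b / (c + 1)) *: y).
rewrite quadratic_formDZ x0 -/b -/c add0r => H.
have : 0 < b ^+ 2 by rewrite exprn_even_gt0.
have -> : b ^+ 2 = (c + 1) ^+ 2 / (c + 2) *
    - (- b / (c + 1) * b *+ 2 + (- b / (c + 1)) ^+ 2 * c).
  by field; rewrite !gt_eqF// ltr_wpDl.
apply/negP; rewrite -leNgt mulr_ge0_le0// ?oppr_le0//.
by rewrite divr_ge0 ?sqr_ge0// addr_ge0.
Qed.

Hypothesis unitG : G \in unitmx.
Context (z : 'cV[R]_n).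
Hypothesis z0 : z != 0.

(** The value is the form of [G] at [x = z^T G^-1]. Were it 0, [psd_kernel] at [y = z^T] would give
    [z^T z = 0], a vanishing sum of squares. Semidefiniteness and invertibility of [G] thus
    suffice. *)
Lemma inverse_form_gt0 : 0 < (z^T *m invmx G *m z) 0 0.
Proof.
pose x := z^T *m invmx G.
have xG : x *m G = z^T by rewrite mulmxKV.
have zx : (x *m G *m x^T) 0 0 = (z^T *m invmx G *m z) 0 0.
  by rewrite xG trmx_mul trmxK mulmxA trmx_inv symG.
rewrite -zx lt_neqAle psdG andbT eq_sym; apply/eqP => /psd_kernel/(_ z^T).
rewrite xG trmxK => /eqP; rewrite mxE psumr_eq0; last first.
  by move=> i _; rewrite !mxE -expr2 sqr_ge0.
move=> /allP zz; move/negP: z0; apply; apply/eqP/matrixP => i j.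
have := zz i (mem_index_enum i); rewrite !mxE mulf_eq0 orbb ord1 => /eqP.
by [].
Qed.

(** Generalized least squares weights; the scalar factor normalizes their product with [z] to 1,
    which is the unbiasedness constraint. *)
Definition blue_weights : 'rV_n :=
  ((z^T *m invmx G *m z) 0 0)^-1 *: (z^T *m invmx G).

(** Since [u G] is a multiple of [z^T], [u G y^T] takes the same value for all [y] with [y z = 1],
    in particular for [u] and [v]. Hence the form at [v - u] is the difference of the two sides. *)
Lemma gauss_markov (v : 'rV_n) : (v *m z) 0 0 = 1 ->
  (blue_weights *m G *m blue_weights^T) 0 0 <= (v *m G *m v^T) 0 0.
Proof.
move=> vz; rewrite /blue_weights; set den := (_ *m z) 0 0.
set u := den^-1 *: _.
have den0 : den != 0 by rewrite gt_eqF// inverse_form_gt0.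
have uG : u *m G = den^-1 *: z^T by rewrite -scalemxAl mulmxKV.
have uv (y : 'rV_n) : (y *m z) 0 0 = 1 -> (u *m G *m y^T) 0 0 = den^-1.
  move=> yz; rewrite uG -scalemxAl mxE -[z^T *m y^T]trmxK trmx_mul !trmxK.
  by rewrite [(_)^T _ _]mxE yz mulr1.
have uz : (u *m z) 0 0 = 1 by rewrite -scalemxAl mxE mulVf.
have := psdG (v + (-1) *: u); rewrite quadratic_formDZ quadratic_formC.
rewrite !uv// mulN1r sqrrN expr1n mul1r => H.
by move: H; set a := (v *m G *m v^T) 0 0; lra.
Qed.

End quadratic_form.

(** * Covariance as a real bilinear form on square-integrable variables *)

Section covariance_matrix.
Context d (T : measurableType d) (R : realType) (P : probability T R).
Implicit Types X Y Z : T -> R.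

(** [fine] loses nothing on square-integrable variables, whose covariance is finite, and it allows
    algebra in [R]. *)
Definition cov X Y : R := fine (covariance P X Y).

Lemma covariance_EFin X Y : X \in Lfun P 2%:E -> Y \in Lfun P 2%:E ->
  covariance P X Y = (cov X Y)%:E.
Proof.
move=> X2 Y2; rewrite fineK// covariance_fin_num ?Lfun2_mul_Lfun1//;
  exact: (Lfun_subset12 (fin_num_measure P _ measurableT)).
Qed.

Lemma Lfun2D X Y : X \in Lfun P 2%:E -> Y \in Lfun P 2%:E ->
  X + Y \in Lfun P 2%:E.
Proof. by move=> X2 Y2; rewrite rpredD ?lee1n. Qed.

Lemma Lfun2Z a X : X \in Lfun P 2%:E -> a *: X \in Lfun P 2%:E.
Proof. by move=> X2; rewrite rpredZ ?lee1n. Qed.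

Lemma Lfun2_sum I (r : seq I) (X : I -> T -> R) :
  (forall i, X i \in Lfun P 2%:E) -> \sum_(i <- r) X i \in Lfun P 2%:E.
Proof. by move=> X2; rewrite rpred_sum ?lee1n. Qed.

Lemma covC X Y : cov X Y = cov Y X.
Proof. by rewrite /cov covarianceC. Qed.

Lemma cov0l X : cov 0 X = 0.
Proof. by rewrite /cov -[0]/(cst 0) covariance_cst_l. Qed.

Lemma cov_ge0 X : 0 <= cov X X.
Proof. by rewrite /cov fine_ge0// -/(variance P X) variance_ge0. Qed.

Lemma covDl X Y Z : X \in Lfun P 2%:E -> Y \in Lfun P 2%:E ->
  Z \in Lfun P 2%:E -> cov (X + Y) Z = cov X Z + cov Y Z.
Proof.
move=> X2 Y2 Z2; apply: EFin_inj.
by rewrite EFinD -!covariance_EFin ?Lfun2D//; exact: covarianceDl.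
Qed.

Lemma covZl a X Z : X \in Lfun P 2%:E -> Z \in Lfun P 2%:E ->
  cov (a *: X) Z = a * cov X Z.
Proof.
move=> X2 Z2; have sub12 := Lfun_subset12 (fin_num_measure P _ measurableT).
have -> : a *: X = a \o* X by apply/funext => w /=; rewrite mulrC.
apply: EFin_inj.
by rewrite EFinM -!covariance_EFin ?Lfun_scale ?ler1n//
  covarianceZl ?Lfun2_mul_Lfun1 ?sub12.
Qed.

Lemma covBl X Y Z : X \in Lfun P 2%:E -> Y \in Lfun P 2%:E ->
  Z \in Lfun P 2%:E -> cov (X - Y) Z = cov X Z - cov Y Z.
Proof. by move=> *; rewrite -scaleN1r covDl ?Lfun2Z// covZl// mulN1r. Qed.

Lemma cov_suml I (r : seq I) (X : I -> T -> R) Z :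
  (forall i, X i \in Lfun P 2%:E) -> Z \in Lfun P 2%:E ->
  cov (\sum_(i <- r) X i) Z = \sum_(i <- r) cov (X i) Z.
Proof.
move=> X2 Z2; elim: r => [|i r IH]; last first.
  by rewrite !big_cons covDl ?IH// Lfun2_sum.
by rewrite !big_nil cov0l.
Qed.

(** Allowing several rows covers both a change of variables and, for [m = 1], a single weighted
    sum. *)
Definition lin_comb m n (A : 'M[R]_(m, n)) (X : 'I_n -> T -> R) (i : 'I_m) : T -> R :=
  \sum_j A i j *: X j.

Definition cov_mx n (X : 'I_n -> T -> R) : 'M[R]_n := \matrix_(i, j) cov (X i) (X j).

Lemma cov_mx_lin_comb m n (A : 'M[R]_(m, n)) (X : 'I_n -> T -> R) :
  (forall i, X i \in Lfun P 2%:E) ->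
  cov_mx (lin_comb A X) = A *m cov_mx X *m A^T.
Proof.
move=> X2; apply/matrixP => i j; rewrite !mxE.
have AX2 k : lin_comb A X k \in Lfun P 2%:E.
  by apply: Lfun2_sum => l; exact: Lfun2Z.
rewrite /lin_comb cov_suml//; last 2 first.
- by move=> k; rewrite Lfun2Z.
- exact: AX2.
under eq_bigr => k _.
  rewrite covZl ?AX2// covC cov_suml; [|by move=> l; rewrite Lfun2Z|by []].
  under eq_bigr => l _ do rewrite covZl// covC.
  rewrite mulr_sumr.
  over.
rewrite exchange_big; apply: eq_bigr => l _ /=.
rewrite !mxE mulr_suml; apply: eq_bigr => k _.
by rewrite !mxE; ring.
Qed.

Lemma cov_mx_sym n (X : 'I_n -> T -> R) : (cov_mx X)^T = cov_mx X.
Proof. by apply/matrixP => i j; rewrite !mxE covC. Qed.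

(** The form at [x] is the variance of the combination of the [X i] with weights [x]. *)
Lemma cov_mx_psd n (X : 'I_n -> T -> R) (x : 'rV_n) :
  (forall i, X i \in Lfun P 2%:E) -> 0 <= (x *m cov_mx X *m x^T) 0 0.
Proof. by move=> X2; rewrite -cov_mx_lin_comb// mxE cov_ge0. Qed.

Lemma expectation_sqr X : X \in Lfun P 2%:E -> ('E_P[X] = 0)%E ->
  ('E_P[fun w => (X w ^+ 2)%R] = (cov X X)%:E)%E.
Proof.
move=> X2 X0; rewrite -covariance_EFin// -/(variance P X) varianceE// X0.
by rewrite expe2 mule0 sube0.
Qed.

End covariance_matrix.

(** * Covariances and means determined by laws *)

Section covariance_laws.
Context d (T : measurableType d) (R : realType) (P : probability T R).
Implicit Types X Y : T -> R.

Lemma cov_sqrD X Y : X \in Lfun P 2%:E -> Y \in Lfun P 2%:E ->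
  cov P (X + Y) (X + Y) = cov P X X + cov P X Y *+ 2 + cov P Y Y.
Proof.
move=> X2 Y2; rewrite covDl ?Lfun2D// !(covC P _ (_ + _)) !covDl//.
by rewrite (covC P Y X); ring.
Qed.

(** Reduces covariances to variances of single variables, which is what equality of laws of linear
    combinations controls. *)
Lemma cov_polarization X Y : X \in Lfun P 2%:E -> Y \in Lfun P 2%:E ->
  cov P X Y = (cov P (X + Y) (X + Y) - cov P (X - Y) (X - Y)) / 4.
Proof.
move=> X2 Y2; have NY2 := Lfun2Z (-1) Y2.
rewrite -[- Y]scaleN1r !cov_sqrD// !(covC P _ (_ *: _)) !covZl//.
by rewrite !(covC P _ (_ *: _)) !covZl// (covC P Y X); field.
Qed.

Lemma cov_eq_law X Y : X \in Lfun P 2%:E -> Y \in Lfun P 2%:E ->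
  (forall A : set R, measurable A -> P (X @^-1` A) = P (Y @^-1` A)) ->
  cov P X X = cov P Y Y.
Proof.
move=> X2 Y2 XY; have sub12 := Lfun_subset12 (fin_num_measure P _ measurableT).
have mL Z : Z \in Lfun P 2%:E -> measurable_fun setT Z.
  by rewrite inE => /andP[/[!inE]].
rewrite /cov -!/(variance P _) !varianceE//.
have sq : ('E_P[X ^+ 2] = 'E_P[Y ^+ 2])%E.
  apply: (@expectation_eq_law _ _ _ P X Y (fun x => x ^+ 2)) => //.
  - exact: mL.
  - exact: mL.
  - exact: (Lfun2_mul_Lfun1 X2 X2).
  - exact: (Lfun2_mul_Lfun1 Y2 Y2).
have mean : ('E_P[X] = 'E_P[Y])%E.
  apply: (@expectation_eq_law _ _ _ P X Y id) => //.
  - exact: mL.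
  - exact: mL.
  - exact: sub12.
  - exact: sub12.
by rewrite sq mean.
Qed.

Lemma expectation_lin_comb m n (A : 'M[R]_(m, n)) (X : 'I_n -> T -> R) (i : 'I_m) :
  (forall j, X j \in Lfun P 1) -> (forall j, 'E_P[X j] = 0)%E ->
  ('E_P[lin_comb A X i] = 0)%E.
Proof.
move=> X1 X0; rewrite /lin_comb.
have scale1 a Z : Z \in Lfun P 1 -> a *: Z \in Lfun P 1 /\
    ('E_P[a *: Z] = a%:E * 'E_P[Z])%E.
  move=> Z1; have -> : a *: Z = a \o* Z by apply/funext => w /=; rewrite mulrC.
  by rewrite expectationZl// Lfun_scale.
(* [expectation_sum] ranges over a list of random variables, so the sum is first reindexed by the
   list of its terms. *)
rewrite -(big_map (fun j => A i j *: X j) xpredT id) expectation_sum.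
  rewrite big_map big1// => j _.
  by have [_ ->] := scale1 (A i j) _ (X1 j); rewrite X0 mule0.
by move=> _ /mapP[j _ ->]; have [] := scale1 (A i j) _ (X1 j).
Qed.

End covariance_laws.

(** * Increments and variance growth of the stationary-increment process *)

Section stationary_process.
Context d (T : measurableType d) (R : realType) (P : probability T R).
Context (B : R -> {RV P >-> R}) (h : R).
Hypothesis h0 : 0 < h.
Hypothesis gaussB : centered_gaussian_process P (fun t => B t).
Hypothesis statB : stationary_increments P (fun t => B t).
Hypothesis B0 : forall w, B 0 w = 0.

Lemma process_gaussian t : 0 <= t -> centered_gaussian P (B t).
Proof.
move=> t0; have := gaussB (fun _ : 'I_1 => 1) (fun=> t0).
by under eq_fun do rewrite big_ord1 mul1r.
Qed.

Lemma process_Lfun2 t : 0 <= t -> (B t : T -> R) \in Lfun P 2%:E.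
Proof. by move=> t0; apply: centered_gaussian_Lfun2 => //; exact: process_gaussian. Qed.

Lemma process_mean0 t : 0 <= t -> ('E_P[B t] = 0)%E.
Proof. by move=> t0; apply: centered_gaussian_mean0 => //; exact: process_gaussian. Qed.

(** By polarization only the variances of a sum and a difference matter, and stationarity equates
    the laws of these two-point combinations. *)
Lemma stationary_cov s t t' : 0 <= s -> 0 <= t -> 0 <= t' ->
  cov P ((B (t + s) : T -> R) - B s) ((B (t' + s) : T -> R) - B s) =
  cov P (B t) (B t').
Proof.
move=> s0 t0 t'0.
have L2 := process_Lfun2.
have L2B u : 0 <= u -> (B (u + s) : T -> R) - B s \in Lfun P 2%:E.
  by move=> u0; rewrite -scaleN1r Lfun2D ?Lfun2Z ?(L2 _ s0) ?(L2 _ (addr_ge0 u0 s0)).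
(* The coefficient [e] serves both cases of the polarization identity, [e = 1] and [e = - 1]. *)
have law (e : R) : cov P ((B (t + s) : T -> R) - B s + e *: ((B (t' + s) : T -> R) - B s))
      ((B (t + s) : T -> R) - B s + e *: ((B (t' + s) : T -> R) - B s)) =
    cov P ((B t : T -> R) + e *: (B t' : T -> R)) ((B t : T -> R) + e *: (B t' : T -> R)).
  apply: cov_eq_law => [||A mA].
  - by apply: Lfun2D; [|apply: Lfun2Z]; exact: L2B.
  - by apply: Lfun2D; [|apply: Lfun2Z]; exact: L2.
  pose tt (i : 'I_2) := if i == 0 then t else t'.
  pose ee (i : 'I_2) := if i == 0 then 1 else e.
  have tt0 i : 0 <= tt i by rewrite /tt; case: ifP.
  have -> : (B (t + s) : T -> R) - B s + e *: ((B (t' + s) : T -> R) - B s) =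
      (fun w => \sum_(i < 2) ee i * (B (tt i + s) w - B s w)).
    by apply/funext => w; rewrite big_ord_recr/= big_ord1 /tt /ee/= mul1r.
  have -> : (B t : T -> R) + e *: (B t' : T -> R) =
      (fun w => \sum_(i < 2) ee i * B (tt i) w).
    by apply/funext => w; rewrite big_ord_recr/= big_ord1 /tt /ee/= mul1r.
  exact: statB.
have := law 1; have := law (- 1); rewrite !scaleN1r !scale1r => lawN lawP.
by rewrite cov_polarization ?L2B// lawN lawP -cov_polarization ?L2.
Qed.

Definition process_incr (k : nat) : T -> R :=
  (B (k.+1%:R * h) : T -> R) - B (k%:R * h).

Let nh0 (k : nat) : 0 <= k%:R * h.
Proof. by rewrite mulr_ge0// ltW. Qed.

Lemma process_incr_Lfun2 k : process_incr k \in Lfun P 2%:E.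
Proof. by rewrite /process_incr -scaleN1r Lfun2D ?Lfun2Z ?process_Lfun2. Qed.

Lemma process_incr_mean0 k : ('E_P[process_incr k] = 0)%E.
Proof.
have sub12 := Lfun_subset12 (fin_num_measure P _ measurableT).
rewrite [LHS](_ : _ = 'E_P[(B (k.+1%:R * h) : T -> R) \- B (k%:R * h)])%E//.
by rewrite expectationB ?sub12 ?process_Lfun2// !process_mean0// sube0.
Qed.

Let r k := cov P (process_incr k) (B h).

(** Both increments are written through values relative to time [i h]; shifting the origin there
    turns increment [i] into [B h] and increment [i + k] into increment [k]. *)
Lemma cov_process_incr i k : cov P (process_incr (i + k)) (process_incr i) = r k.
Proof.
have shift (j : nat) : ((i + j)%:R * h = j%:R * h + i%:R * h :> R).
  by rewrite natrD mulrDl addrC.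
have L2B j : (B ((i + j)%:R * h) : T -> R) - B (i%:R * h) \in Lfun P 2%:E.
  by rewrite -scaleN1r Lfun2D ?Lfun2Z ?process_Lfun2.
have -> : process_incr (i + k) = ((B ((i + k.+1)%:R * h) : T -> R) - B (i%:R * h)) -
    ((B ((i + k)%:R * h) : T -> R) - B (i%:R * h)).
  by rewrite /process_incr addnS opprB addrA subrK.
have -> : process_incr i = (B (h + i%:R * h) : T -> R) - B (i%:R * h).
  by rewrite /process_incr -natr1 mulrDl mul1r (addrC h).
have h0' := ltW h0.
have L2h : (B (h + i%:R * h) : T -> R) - B (i%:R * h) \in Lfun P 2%:E.
  by rewrite -scaleN1r Lfun2D ?Lfun2Z ?process_Lfun2 ?addr_ge0.
rewrite covBl; [|exact: L2B|exact: L2B|exact: L2h].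
rewrite !shift !stationary_cov//.
apply/esym; apply: covBl; exact: process_Lfun2.
Qed.

Lemma process_sum_incr n : (B (n%:R * h) : T -> R) = \sum_(i < n) process_incr i.
Proof.
rewrite -(big_mkord xpredT process_incr).
rewrite (@telescope_sumr_eq _ 0 n (fun k => B (k%:R * h) : T -> R))// mul0r.
have -> : (B 0 : T -> R) = 0 by apply/funext => w; exact: B0.
by rewrite subr0.
Qed.

(** Expanding the square of [B_{nh}] plus increment [n] gives the cross term [r 1 + ... + r n],
    counted twice, and the diagonal term [r 0], counted once. *)
Lemma var_process_step n :
  cov P (B (n.+1%:R * h)) (B (n.+1%:R * h)) <=
  cov P (B (n%:R * h)) (B (n%:R * h)) + 2 * \sum_(k < n.+1) `|r k|.
Proof.
have -> : (B (n.+1%:R * h) : T -> R) = (B (n%:R * h) : T -> R) + process_incr n.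
  by rewrite !process_sum_incr big_ord_recr.
have L2 := process_Lfun2; have Y2 := process_incr_Lfun2.
rewrite cov_sqrD; [|exact: L2|exact: Y2].
have := cov_process_incr n 0; rewrite addn0 => ->.
have cross : cov P (B (n%:R * h)) (process_incr n) <= \sum_(k < n) `|r k.+1|.
  (* Reversing the sum pairs increment [n] with increment [n - (k + 1)], at lag [k + 1]. *)
  rewrite process_sum_incr cov_suml// (reindex_inj rev_ord_inj)/=.
  apply: ler_sum => k _; rewrite covC -[X in process_incr X](@subnK (n - k.+1)) ?leq_subr//.
  by rewrite addnC cov_process_incr subKn// ler_norm.
have -> : \sum_(k < n.+1) `|r k| = `|r 0| + \sum_(k < n) `|r k.+1|.
  by rewrite big_ord_recl.
by move: (ler_norm (r 0)) (normr_ge0 (r 0)) cross; lra.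
Qed.

(** The partial sums of [|r k|] are nondecreasing, so each of the [n] steps is bounded by the last
    sum. *)
Lemma var_process_le n :
  cov P (B (n%:R * h)) (B (n%:R * h)) <= 2 * n%:R * \sum_(k < n) `|r k|.
Proof.
elim: n => [|n IH].
  rewrite big_ord0 mulr0 process_sum_incr big_ord0.
  by rewrite cov0l.
apply: (le_trans (var_process_step n)).
rewrite -(natr1 n) mulrDr mulrDl mulr1 lerD2r; apply: (le_trans IH).
by rewrite ler_wpM2l ?mulr_ge0// big_ord_recr lerDl.
Qed.

(** * The covariance matrix of the increments and the error of the estimator *)

Lemma Gamma_cov_mx N :
  Gamma P (fun t => B t) h N = cov_mx P (fun i : 'I_N => process_incr i).
Proof. by apply/matrixP => i j; rewrite !mxE. Qed.

(** Differencing is a triangular change of variables with unit diagonal, so it preserves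
    invertibility of the covariance matrix. *)
Lemma Gamma_unit N : cov_values P (fun t => B t) h N \in unitmx ->
  Gamma P (fun t => B t) h N \in unitmx.
Proof.
move=> unitV.
(* Row [i] has 1 in column [i] and -1 in column [i - 1]; row 0 has no -1, which is correct because
   [B 0 = 0]. *)
pose D : 'M[R]_N := \matrix_(i, j) ((j == i)%:R - (j.+1 == i :> nat)%:R).
pose V (i : 'I_N) : T -> R := B (i.+1%:R * h).
have incrE (i : 'I_N) : process_incr i = lin_comb D V i.
  rewrite /lin_comb; under eq_bigr do rewrite mxE scalerBl.
  rewrite big_split/= sumrN (bigD1 i)//= eqxx scale1r big1 ?addr0; last first.
    by move=> j /negPf ->; rewrite scale0r.
  congr (_ - _); case: i => -[|i] iN /=.
    rewrite mul0r big1; last by move=> j _; rewrite scale0r.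
    by apply/funext => w; exact: B0.
  rewrite (bigD1 (Ordinal (ltnW iN)))//= eqxx scale1r big1 ?addr0//.
  move=> j jN; rewrite eqSS; case: eqP => [ji|_]; last by rewrite scale0r.
  by move: jN; rewrite -val_eqE /= ji eqxx.
have -> : Gamma P (fun t => B t) h N = D *m cov_values P (fun t => B t) h N *m D^T.
  rewrite Gamma_cov_mx (_ : (fun i : 'I_N => process_incr i) = lin_comb D V).
    by rewrite cov_mx_lin_comb// => i; exact: process_Lfun2.
  by apply/funext => i; exact: incrE.
have unitD : D \in unitmx.
  rewrite unitmxE det_trig.
    rewrite big1 ?unitr1// => i _; rewrite mxE eqxx.
    by rewrite gtn_eqF ?subr0.
  apply/is_trig_mxP => i j ij; rewrite mxE.
  by rewrite -val_eqE !gtn_eqF ?subrr// ltnW.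
by rewrite !unitmx_mul unitmx_tr unitD unitV.
Qed.

Let z N : 'cV[R]_N := const_mx h.

Lemma z_neq0 N : (0 < N)%N -> z N != 0.
Proof.
case: N => // N _; apply/eqP => /matrixP/(_ 0 0); rewrite !mxE => h_eq0.
by move: h0; rewrite h_eq0 ltxx.
Qed.

(** The increments of [X] are [theta z] plus those of [B]; the weights send [theta z] to [theta],
    leaving only weighted noise. *)
Lemma theta_hat_sub theta N : (0 < N)%N ->
  cov_values P (fun t => B t) h N \in unitmx ->
  (fun w => theta_hat P (fun t => B t) theta h N w - theta) =
  lin_comb (blue_weights (Gamma P (fun t => B t) h N) (z N))
    (fun i : 'I_N => process_incr i) (0 : 'I_1).
Proof.
move=> N0 unitV; apply/funext => w.
have den_gt0 : 0 < ((z N)^T *m invmx (Gamma P (fun t => B t) h N) *m z N) 0 0.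
  apply: inverse_form_gt0; [| |exact: Gamma_unit|exact: z_neq0].
    by rewrite Gamma_cov_mx cov_mx_sym.
  by move=> x; rewrite Gamma_cov_mx; apply: cov_mx_psd => i; exact: process_incr_Lfun2.
rewrite /theta_hat /blue_weights -/(z N); move: den_gt0.
set u := (z N)^T *m _; set den := (u *m z N) 0 0 => den_gt0.
have -> : incr (fun t w' => theta * t + B t w') h N w =
    theta *: z N + \col_i process_incr i w.
  apply/matrixP => i j; rewrite !mxE.
  rewrite -[process_incr i w]/(B (i.+1%:R * h) w - B (i%:R * h) w) -(natr1 i).
  by ring.
have thetaE : (theta *: (u *m z N)) 0 0 = theta * den by rewrite [LHS]mxE.
rewrite mulmxDr -scalemxAr mxE thetaE.
rewrite mulrDl mulfK ?gt_eqF// addrC addKr.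
rewrite /lin_comb fct_sumE mxE mulr_suml; apply: eq_bigr => i _.
by rewrite !mxE -[RHS]/(_ * _) mulrC mulrA.
Qed.

(** The real witness [e] records that the error is finite, so that the bound can be proved in
    [R]. *)
Lemma mse_le theta N : (0 < N)%N ->
  cov_values P (fun t => B t) h N \in unitmx ->
  exists2 e : R,
    ('E_P[fun w => ((theta_hat P (fun t => B t) theta h N w - theta) ^+ 2)%R] = e%:E)%E &
    0 <= e <= 2 / h ^+ 2 * (N%:R^-1 * \sum_(k < N) `|r k|).
Proof.
move=> N0 unitV; have Y2 := process_incr_Lfun2.
have sub12 := Lfun_subset12 (fin_num_measure P _ measurableT).
have NR0 : N%:R != 0 :> R by rewrite pnatr_eq0 -lt0n.
have hneq0 : h != 0 by rewrite gt_eqF.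
set u := blue_weights (Gamma P (fun t => B t) h N) (z N).
pose Y (i : 'I_N) := process_incr i.
have uY2 : lin_comb u Y 0 \in Lfun P 2%:E.
  by apply: Lfun2_sum => i; apply: Lfun2Z; exact: Y2.
have errE := theta_hat_sub theta N0 unitV.
exists (cov P (lin_comb u Y 0) (lin_comb u Y 0)).
  rewrite -expectation_sqr//; last first.
    apply: expectation_lin_comb => i; first by apply: sub12; exact: Y2.
    exact: process_incr_mean0.
  by rewrite -errE.
rewrite cov_ge0 /=.
have quad (x : 'rV[R]_N) : cov P (lin_comb x Y 0) (lin_comb x Y 0) =
    (x *m Gamma P (fun t => B t) h N *m x^T) 0 0.
  by rewrite Gamma_cov_mx -cov_mx_lin_comb ?mxE// => i; exact: Y2.
(* The competitor is the endpoint estimator [X_{Nh} / (N h)]: its weights satisfy [v z = 1] and its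
   error telescopes to [B_{Nh} / (N h)]. *)
pose v : 'rV[R]_N := const_mx (N%:R * h)^-1.
have vz : (v *m z N) 0 0 = 1.
  rewrite mxE; under eq_bigr do rewrite !mxE.
  by rewrite sumr_const card_ord -[LHS]mulr_natl invfM -mulrA mulVf// mulr1 mulfV.
have vY : lin_comb v Y 0 = (N%:R * h)^-1 *: (B (N%:R * h) : T -> R).
  by rewrite process_sum_incr scaler_sumr; apply: eq_bigr => i _; rewrite mxE.
have : cov P (lin_comb u Y 0) (lin_comb u Y 0) <= cov P (lin_comb v Y 0) (lin_comb v Y 0).
  rewrite !quad; apply: gauss_markov => //.
  - by rewrite Gamma_cov_mx cov_mx_sym.
  - by move=> x; rewrite Gamma_cov_mx; apply: cov_mx_psd => i; exact: Y2.
  - exact: Gamma_unit.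
  - exact: z_neq0.
move/le_trans; apply.
have BN2 : (B (N%:R * h) : T -> R) \in Lfun P 2%:E by exact: process_Lfun2.
rewrite vY covZl ?Lfun2Z// covC covZl//.
have -> : 2 / h ^+ 2 * (N%:R^-1 * \sum_(k < N) `|r k|) =
    (N%:R * h)^-1 * ((N%:R * h)^-1 * (2 * N%:R * \sum_(k < N) `|r k|)).
  by field; rewrite NR0 hneq0.
by rewrite !ler_wpM2l ?invr_ge0// var_process_le.
Qed.

End stationary_process.

(** * Passage to the limit by Cesaro means *)

Theorem theorem2p5 (d : measure_display) (T : measurableType d) (R : realType)
  (P : probability T R) (B : R -> {RV P >-> R}) (theta h : R) :
  0 < h ->
  centered_gaussian_process P (fun t => B t) ->
  stationary_increments P (fun t => B t) ->
  (forall w, B 0 w = 0) ->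
  (forall N : nat, (0 < N)%N -> cov_values P (fun t => B t) h N \in unitmx) ->
  (fun k : nat => covariance P (fun w => B (k.+1%:R * h) w - B (k%:R * h) w)
                               (B h)) @ \oo --> 0%E ->
  (fun N : nat =>
     ('E_P[fun w => (theta_hat P (fun t => B t) theta h N w - theta)%R ^+ 2]%R)%E)
    @ \oo --> 0%E.
Proof.
move=> h0 gaussB statB B0 unitV cov0.
pose r k := cov P (process_incr B h k) (B h).
have r0 : `|r k| @[k --> \oo] --> 0.
  have : `|r k| @[k --> \oo] --> `|0 : R|.
    by apply: cvg_norm; exact: (fine_cvg cov0).
  by rewrite normr0.
have bound0 : 2 / h ^+ 2 * arithmetic_mean (fun k => `|r k|) n @[n --> \oo] --> 0.
  by rewrite -[X in _ --> X](mulr0 (2 / h ^+ 2)); apply: cvgM; [exact: cvg_cst|exact: cesaro].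
have boundE0 : (2 / h ^+ 2 * arithmetic_mean (fun k => `|r k|) n)%:E @[n --> \oo]
    --> 0%E.
  by apply: cvg_EFin => //; exact: nearW.
rewrite -cvg_shiftS; apply: (squeeze_cvge _ (cvg_cst 0%E) boundE0).
apply: nearW => n /=.
have [e -> /andP[e0 eb]] :=
  mse_le h0 gaussB statB B0 theta (ltn0Sn n) (unitV n.+1 (ltn0Sn n)).
by rewrite !lee_fin e0 /= (le_trans eb)// /arithmetic_mean /= seriesEord.
Qed.
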